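(* There exists a positive integer $N$ such that for every odd integer $n \ge N$ and every integer $m \ge 2$ the following holds. Let $B(m,n)$ be the free Burnside group of rank $m$ and exponent $n$, and let $a_1, a_2$ be (two distinct members of a system of) free generators of $B(m,n)$. Denote $c := a_1 a_2 a_1^{-1} a_2^{-1}$ and let $$A := (1 + c + \dots + c^{n-1})(1 - a_1 a_2 a_1^{-1}), \qquad B := (1 - a_1)(1 + a_2 + \dots + a_2^{n-1}).$$ Then $AB = 0$ in $\mathbb{Z}[B(m,n)]$, and $A, B$ is a nontrivial pair of zero-divisors in $\mathbb{Z}[B(m,n)]$.
   Context: For a group $G$, $\mathbb{Z}[G]$ denotes the integral group ring of $G$. A pair of zero-divisors in $\mathbb{Z}[G]$ is a pair $A, B \in \mathbb{Z}[G]$ with $A \neq 0$, $B \neq 0$ and $AB = 0$. Such a pair is called trivial if there are $X, Y \in \mathbb{Z}[G]$ and an element $h \in G$ of finite order $q > 1$ such that either $A = X(1-h)$ and $B = (1 + h + \dots + h^{q-1})Y$, or $A = X(1 + h + \dots + h^{q-1})$ and $B = (1-h)Y$. A pair of zero-divisors is nontrivial if it is not trivial. The free Burnside group $B(m,n)$ of rank $m$ and exponent $n$ is the quotient $F_m / F_m^n$, where $F_m$ is the free group of rank $m$ with free generators $b_1, \dots, b_m$ and $F_m^n$ is the (normal) subgroup of $F_m$ generated by all $n$th powers of elements of $F_m$. Free generators $a_1, \dots, a_m$ of $B(m,n)$ are the images of $b_1, \dots, b_m$ under the natural homomorphism $F_m \to B(m,n)$. *)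

(* Defs.v *)
From HB Require Import structures.
From mathcomp Require Import monalg.
From mathcomp Require Import all_boot all_order all_algebra.
From mathcomp Require Import boolp finmap.

Set Implicit Arguments.
Unset Strict Implicit.
Unset Printing Implicit Defensive.

Import GRing.Theory.

Local Open Scope quotient_scope.
Local Open Scope group_scope.

Section FreeGroup.
Variable I : choiceType.

(* The letter (i, true) stands for the generator i, (i, false) for its
   inverse. *)
Definition word := seq (I * bool).

Inductive free_cong : word -> word -> Prop :=
| FreeCancel u v i e :
    free_cong (u ++ [:: (i, e); (i, ~~ e)] ++ v) (u ++ v)
| FreeRefl u : free_cong u u
| FreeSym u v : free_cong u v -> free_cong v u
| FreeTrans u v w : free_cong u v -> free_cong v w -> free_cong u w.

Definition free_rel (u v : word) : bool := `[< free_cong u v >].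

Lemma free_rel_refl : reflexive free_rel.
Proof. by move=> u; apply/asboolP/FreeRefl. Qed.

Lemma free_rel_sym : symmetric free_rel.
Proof. by move=> u v; apply/asboolP/asboolP; apply: FreeSym. Qed.

Lemma free_rel_trans : transitive free_rel.
Proof.
by move=> v u w /asboolP uv /asboolP vw; apply/asboolP/(FreeTrans uv vw).
Qed.

Canonical free_equiv := EquivRel free_rel free_rel_refl free_rel_sym
  free_rel_trans.

Definition free_group := {eq_quot free_equiv}.

HB.instance Definition _ := Choice.on free_group.
HB.instance Definition _ := EqQuotient.on free_group.

Lemma free_congP (u v : word) :
  (\pi_free_group u = \pi_free_group v) <-> free_cong u v.
Proof. by split=> [/eqmodP/asboolP | uv]; last exact/eqmodP/asboolP. Qed.

Lemma free_cong_cat u u' v v' :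
  free_cong u u' -> free_cong v v' -> free_cong (u ++ v) (u' ++ v').
Proof.
move=> uu' vv'; apply: (@FreeTrans _ (u' ++ v)).
  elim: uu' => [w z i e|w|w z _ /FreeSym//|w z t _ h1 _ h2].
  - by rewrite -!catA; apply: FreeCancel.
  - exact: FreeRefl.
  - exact: FreeTrans h1 h2.
elim: vv' => [w z i e|w|w z _ /FreeSym//|w z t _ h1 _ h2].
- by rewrite !(catA u'); apply: FreeCancel.
- exact: FreeRefl.
- exact: FreeTrans h1 h2.
Qed.

Definition winv (u : word) : word := rev [seq (x.1, ~~ x.2) | x <- u].

Lemma winv_cat u v : winv (u ++ v) = winv v ++ winv u.
Proof. by rewrite /winv map_cat rev_cat. Qed.

Lemma winvK : involutive winv.
Proof.
move=> u; rewrite /winv map_rev revK -map_comp -[RHS]map_id.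
by apply: eq_map => -[i e] /=; rewrite negbK.
Qed.

Lemma free_cong_inv u v : free_cong u v -> free_cong (winv u) (winv v).
Proof.
elim=> [w z i e|w|w z _ /FreeSym//|w z t _ h1 _ h2].
- rewrite !winv_cat -catA.
  by case: e; [apply: (FreeCancel _ _ i true) | apply: (FreeCancel _ _ i false)].
- exact: FreeRefl.
- exact: FreeTrans h1 h2.
Qed.

Lemma free_cong_winvr u : free_cong (u ++ winv u) [::].
Proof.
elim: u => [|[i e] u ihu]; first exact: FreeRefl.
rewrite -cat1s winv_cat -catA.
apply: (@FreeTrans _ ([:: (i, e)] ++ winv [:: (i, e)])).
  apply: free_cong_cat; first exact: FreeRefl.
  by rewrite catA; apply: (free_cong_cat ihu (FreeRefl _)).
exact: (FreeCancel [::] [::]).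
Qed.

Definition free_one : free_group := \pi_free_group [::].
Definition free_mul (x y : free_group) : free_group :=
  \pi_free_group (repr x ++ repr y).
Definition free_inv (x : free_group) : free_group :=
  \pi_free_group (winv (repr x)).

Lemma free_piM u v :
  free_mul (\pi_free_group u) (\pi_free_group v) = \pi_free_group (u ++ v).
Proof.
by apply/free_congP/free_cong_cat; apply/free_congP; rewrite reprK.
Qed.

Lemma free_piV u : free_inv (\pi_free_group u) = \pi_free_group (winv u).
Proof. by apply/free_congP/free_cong_inv/free_congP; rewrite reprK. Qed.

Lemma free_mulA : associative free_mul.
Proof.
elim/quotW=> u; elim/quotW=> v; elim/quotW=> w.
by rewrite (free_piM u v) (free_piM v w) !free_piM catA.
Qed.

Lemma free_mul1 : left_id free_one free_mul.
Proof. by elim/quotW=> u; rewrite free_piM. Qed.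

Lemma free_mulr1 : right_id free_one free_mul.
Proof. by elim/quotW=> u; rewrite free_piM cats0. Qed.

Lemma free_mulV : left_inverse free_one free_inv free_mul.
Proof.
elim/quotW=> u; rewrite free_piV free_piM; apply/free_congP.
by rewrite -{2}(winvK u); apply: free_cong_winvr.
Qed.

Lemma free_mulrV : right_inverse free_one free_inv free_mul.
Proof.
by elim/quotW=> u; rewrite free_piV free_piM; apply/free_congP/free_cong_winvr.
Qed.

HB.instance Definition _ := isGroup.Build free_group
  free_mulA free_mul1 free_mulr1 free_mulV free_mulrV.

Definition free_gen (i : I) : free_group := \pi_free_group [:: (i, true)].

End FreeGroup.

Definition free_generators (F : groupType) (I : Type) (b : I -> F) : Prop :=
  forall (H : groupType) (h : I -> H),
    exists2 f : {multiplicative F -> H}, (forall i, f (b i) = h i) &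
      forall f' : {multiplicative F -> H}, (forall i, f' (b i) = h i) -> f' =1 f.

Section FreeUniversal.
Variables (I : choiceType) (H : groupType) (h : I -> H).

Definition letter_eval (x : I * bool) : H := if x.2 then h x.1 else (h x.1)^-1.

Definition word_eval (u : word I) : H := \prod_(x <- u) letter_eval x.

Lemma word_eval_cong u v : free_cong u v -> word_eval u = word_eval v.
Proof.
elim=> // [w z i e|w z t _ -> //].
rewrite /word_eval !big_cat !big_cons big_nil /= mulg1; congr (_ * _).
by case: e; rewrite /letter_eval /= ?mulgV ?mulVg mul1g.
Qed.

Definition free_lift (x : free_group I) : H := word_eval (repr x).

Lemma free_lift_pi u : free_lift (\pi_(free_group I) u) = word_eval u.
Proof. by apply/word_eval_cong/free_congP; rewrite reprK. Qed.

Lemma free_liftM : {morph free_lift : x y / x * y}.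
Proof.
elim/quotW=> u; elim/quotW=> v.
by rewrite [_ * _ in LHS]free_piM !free_lift_pi /word_eval big_cat.
Qed.

HB.instance Definition _ :=
  isMultiplicative.Build (free_group I) H free_lift free_liftM.

End FreeUniversal.

Lemma free_gen_free (I : choiceType) : free_generators (@free_gen I).
Proof.
move=> H h; exists (free_lift h : {multiplicative _ -> _}) => [i|f fE].
  by rewrite /= free_lift_pi /word_eval big_seq1.
have f1 : f 1 = 1 by apply: (mulgI (f 1)); rewrite -gmulfM !mulg1.
elim/quotW=> u; rewrite /= free_lift_pi /word_eval.
elim: u => [|[i e] u ihu]; first by rewrite big_nil.
rewrite big_cons -ihu -cat1s -free_piM.
rewrite [LHS]gmulfM; congr (_ * _); rewrite /letter_eval /=.
case: e; first exact: fE.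
have -> : \pi_(free_group I) [:: (i, false)] = (free_gen i)^-1.
  by rewrite [RHS]free_piV.
by apply: (mulgI (f (free_gen i))); rewrite -gmulfM mulgV f1 fE mulgV.
Qed.

Inductive generated (G : groupType) (S : G -> Prop) : G -> Prop :=
| GenIn x : S x -> generated S x
| Gen1 : generated S 1
| GenM x y : generated S x -> generated S y -> generated S (x * y)
| GenV x : generated S x -> generated S x^-1.

Section PowerQuotient.
Variables (G : groupType) (n : nat).

Definition power_subgroup : G -> Prop :=
  generated (fun y => exists x : G, y = x ^+ n).

Lemma power_subgroupJ x y : power_subgroup x -> power_subgroup (x ^ y).
Proof.
elim=> [_ [z ->]||z t _ hz _ ht|z _ hz].
- by rewrite conjXg; apply: GenIn; exists (z ^ y).
- by rewrite conj1g; apply: Gen1.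
- by rewrite conjMg; apply: GenM.
- by rewrite conjVg; apply: GenV.
Qed.

Definition power_rel (x y : G) : bool := `[< power_subgroup (x^-1 * y) >].

Lemma power_rel_refl : reflexive power_rel.
Proof. by move=> x; apply/asboolP; rewrite mulVg; apply: Gen1. Qed.

Lemma power_rel_sym : symmetric power_rel.
Proof.
by move=> x y; apply/asboolP/asboolP => /GenV; rewrite invgM invgK.
Qed.

Lemma power_rel_trans : transitive power_rel.
Proof.
move=> y x z /asboolP xy /asboolP yz; apply/asboolP.
by have := GenM xy yz; rewrite -mulgA mulVKg.
Qed.

Canonical power_equiv := EquivRel power_rel power_rel_refl power_rel_sym
  power_rel_trans.

Definition power_quotient := {eq_quot power_equiv}.

HB.instance Definition _ := Choice.on power_quotient.
HB.instance Definition _ := EqQuotient.on power_quotient.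

Lemma power_quotientP (x y : G) :
  \pi_power_quotient x = \pi_power_quotient y <-> power_subgroup (x^-1 * y).
Proof. by split=> [/eqmodP/asboolP | xy]; last exact/eqmodP/asboolP. Qed.

Definition pq_one : power_quotient := \pi_power_quotient 1.
Definition pq_mul (x y : power_quotient) : power_quotient :=
  \pi_power_quotient (repr x * repr y).
Definition pq_inv (x : power_quotient) : power_quotient :=
  \pi_power_quotient (repr x)^-1.

Lemma pq_piM x y :
  pq_mul (\pi_power_quotient x) (\pi_power_quotient y)
    = \pi_power_quotient (x * y).
Proof.
apply/power_quotientP; set x' := repr _; set y' := repr _.
have hx : power_subgroup (x'^-1 * x) by apply/power_quotientP; rewrite reprK.
have hy : power_subgroup (y'^-1 * y) by apply/power_quotientP; rewrite reprK.
have -> : (x' * y')^-1 * (x * y) = (x'^-1 * x) ^ y' * (y'^-1 * y).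
  by rewrite invgM /conjg !mulgA mulgK.
exact/GenM/hy/power_subgroupJ.
Qed.

Lemma pq_piV x : pq_inv (\pi_power_quotient x) = \pi_power_quotient x^-1.
Proof.
apply/power_quotientP; set x' := repr _.
have /GenV hx : power_subgroup (x'^-1 * x).
  by apply/power_quotientP; rewrite reprK.
have := power_subgroupJ x'^-1 hx.
by rewrite /conjg invgM !invgK !mulgA mulgK.
Qed.

Lemma pq_mulA : associative pq_mul.
Proof.
elim/quotW=> x; elim/quotW=> y; elim/quotW=> z.
by rewrite (pq_piM x y) (pq_piM y z) !pq_piM mulgA.
Qed.

Lemma pq_mul1 : left_id pq_one pq_mul.
Proof. by elim/quotW=> x; rewrite pq_piM mul1g. Qed.

Lemma pq_mulr1 : right_id pq_one pq_mul.
Proof. by elim/quotW=> x; rewrite pq_piM mulg1. Qed.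

Lemma pq_mulV : left_inverse pq_one pq_inv pq_mul.
Proof. by elim/quotW=> x; rewrite pq_piV pq_piM mulVg. Qed.

Lemma pq_mulrV : right_inverse pq_one pq_inv pq_mul.
Proof. by elim/quotW=> x; rewrite pq_piV pq_piM mulgV. Qed.

HB.instance Definition _ := isGroup.Build power_quotient
  pq_mulA pq_mul1 pq_mulr1 pq_mulV pq_mulrV.

Definition pq_proj (x : G) : power_quotient := \pi_power_quotient x.

Lemma pq_projM : {morph pq_proj : x y / x * y}.
Proof. by move=> x y; rewrite [RHS]pq_piM. Qed.

HB.instance Definition _ :=
  isMultiplicative.Build G power_quotient pq_proj pq_projM.

End PowerQuotient.

Definition burnside (m n : nat) : groupType := power_quotient (free_group 'I_m) n.

Definition burnside_proj (m n : nat) :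
    {multiplicative free_group 'I_m -> burnside m n} :=
  @pq_proj (free_group 'I_m) n.

Local Close Scope group_scope.
Local Open Scope ring_scope.

Section GroupRing.
Variables (R : nzRingType) (G : groupType).

(* Finitely supported functions G -> R.  The multiplicative structure of malg
   is only available over monoids without nontrivial units, hence this alias
   with its own convolution product. *)
Definition group_ring : Type := {malg R[G]}.

HB.instance Definition _ := GRing.Zmodule.on group_ring.

Implicit Types f g : group_ring.

Definition gr_elt (x : G) : group_ring := mkmalgU x 1.

Definition gr_mul f g : group_ring :=
  \sum_(x <- msupp f) \sum_(y <- msupp g)
    mkmalgU (x * y)%g (mcoeff x f * mcoeff y g).

Lemma gr_mulw (d1 d2 : {fset G}) f g :
    (msupp f `<=` d1)%fset -> (msupp g `<=` d2)%fset ->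
  gr_mul f g = \sum_(x <- d1) \sum_(y <- d2)
    mkmalgU (x * y)%g (mcoeff x f * mcoeff y g).
Proof.
move=> le1 le2; rewrite /gr_mul (big_fset_incl _ le1) /=.
  apply/eq_bigr=> x _; apply/big_fset_incl => // y _ /mcoeff_outdom ->.
  by rewrite mulr0 monalgU0.
move=> x _ /mcoeff_outdom fx.
by rewrite big1 => // y _; rewrite fx mul0r monalgU0.
Qed.

Lemma gr_mul0 : left_zero 0 gr_mul.
Proof. by move=> f; rewrite /gr_mul msupp0 big_seq_fset0. Qed.

Lemma gr_mulr0 : right_zero 0 gr_mul.
Proof.
by move=> f; rewrite /gr_mul msupp0 big1 // => x _; rewrite big_seq_fset0.
Qed.

Lemma gr_mulUU (a b : R) (x y : G) :
  gr_mul (mkmalgU x a) (mkmalgU y b) = mkmalgU (x * y)%g (a * b).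
Proof. by rewrite (gr_mulw msuppU_le msuppU_le) !big_seq_fset1 !mcoeffUU. Qed.

Lemma gr_mulDl : left_distributive gr_mul +%R.
Proof.
move=> f1 f2 g.
rewrite [in RHS](gr_mulw (fsubsetUl _ (msupp f2)) (fsubset_refl _)).
rewrite [in RHS](gr_mulw (fsubsetUr (msupp f1) _) (fsubset_refl _)).
rewrite (gr_mulw (msuppD_le _ _) (fsubset_refl _)).
rewrite -big_split /=; apply/eq_bigr=> x _.
rewrite -big_split /=; apply/eq_bigr=> y _.
by rewrite mcoeffD mulrDl monalgUD.
Qed.

Lemma gr_mulDr : right_distributive gr_mul +%R.
Proof.
move=> f g1 g2.
rewrite [in RHS](gr_mulw (fsubset_refl _) (fsubsetUl _ (msupp g2))).
rewrite [in RHS](gr_mulw (fsubset_refl _) (fsubsetUr (msupp g1) _)).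
rewrite (gr_mulw (fsubset_refl _) (msuppD_le _ _)).
rewrite -big_split /=; apply/eq_bigr=> x _.
rewrite -big_split /=; apply/eq_bigr=> y _.
by rewrite mcoeffD mulrDr monalgUD.
Qed.

Lemma gr_ind (P : group_ring -> Prop) :
    P 0 -> (forall f g, P f -> P g -> P (f + g)) ->
    (forall x a, P (mkmalgU x a)) ->
  forall f, P f.
Proof. by move=> P0 PD PU f; rewrite (monalgE f); apply: big_ind. Qed.

Lemma gr_mul1 : left_id (gr_elt 1%g) gr_mul.
Proof.
elim/gr_ind=> [|f g hf hg|x a]; first exact: gr_mulr0.
  by rewrite gr_mulDr hf hg.
by rewrite gr_mulUU mul1r mul1g.
Qed.

Lemma gr_mulr1 : right_id (gr_elt 1%g) gr_mul.
Proof.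
elim/gr_ind=> [|f g hf hg|x a]; first exact: gr_mul0.
  by rewrite gr_mulDl hf hg.
by rewrite gr_mulUU mulr1 mulg1.
Qed.

Lemma gr_mulA : associative gr_mul.
Proof.
move=> f g h; elim/gr_ind: f => [|f f' hf hf'|x a]; first by rewrite !gr_mul0.
  by rewrite !gr_mulDl hf hf'.
elim/gr_ind: g => [|g g' hg hg'|y b].
- by rewrite gr_mul0 gr_mulr0 gr_mul0.
- by rewrite !(gr_mulDl, gr_mulDr) hg hg'.
elim/gr_ind: h => [|h h' hh hh'|z c]; first by rewrite !gr_mulr0.
  by rewrite !gr_mulDr hh hh'.
by rewrite !gr_mulUU mulrA mulgA.
Qed.

Lemma gr_one_neq0 : gr_elt 1%g != 0.
Proof. by rewrite /gr_elt monalgU_eq0 oner_eq0. Qed.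

HB.instance Definition _ := GRing.Zmodule_isNzRing.Build group_ring
  gr_mulA gr_mul1 gr_mulr1 gr_mulDl gr_mulDr gr_one_neq0.

Definition gr_geom (x : G) (n : nat) : group_ring :=
  \sum_(k < n) gr_elt (x ^+ k)%g.

End GroupRing.

Arguments gr_elt {R G} x%_g.
Arguments gr_geom {R G} x%_g n%_N.

Definition has_order (G : groupType) (h : G) (q : nat) : Prop :=
  [/\ (0 < q)%N, (h ^+ q)%g = 1%g
    & forall k, (0 < k < q)%N -> (h ^+ k)%g <> 1%g].

Section ZeroDivisors.
Variable G : groupType.
Implicit Types A B X Y : group_ring int G.

Definition zero_divisor_pair A B : Prop := [/\ A <> 0, B <> 0 & A * B = 0].

Definition trivial_pair A B : Prop :=
  exists X Y (h : G) (q : nat),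
    [/\ (1 < q)%N, has_order h q &
        (A = X * (1 - gr_elt h) /\ B = gr_geom h q * Y) \/
        (A = X * gr_geom h q /\ B = (1 - gr_elt h) * Y)].

Definition nontrivial_pair A B : Prop :=
  zero_divisor_pair A B /\ ~ trivial_pair A B.

End ZeroDivisors.

(* Main.v *)
(* Since b := a1 a2 a1^-1 equals c a2 and b a1 = a1 a2, one has
   (1 - b) B = (1 - c) N(a2), where N(x) := 1 + x + ... + x^(n-1), whence
   A B = N(c) (1 - c) N(a2) = 0.

   If B = N(h) Y, then h B = B; comparing the signs of coefficients, h lies in
   <a2> and in its conjugate by a1.  If A = X N(h) and B = (1 - h) Y, then
   A h = A puts h in <c>, and N(h) B = 0 puts a1 in <c> <a2>.  Both can be
   refuted (the first unless h = 1) in the Heisenberg group over Z/n, which has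
   exponent n when n is odd. *)

Require Import Defs.
From HB Require Import structures.
From mathcomp Require Import monalg.
From mathcomp Require Import all_boot all_order all_algebra.
From mathcomp Require Import boolp.
From mathcomp Require Import ring.

Set Implicit Arguments.
Unset Strict Implicit.
Unset Printing Implicit Defensive.

Import GRing.Theory Num.Theory Order.TTheory.
Local Open Scope ring_scope.

(** * Coefficients and signs of geometric sums in the integral group ring *)

Section GroupRingTheory.
Variable G : groupType.
Implicit Types (x y h : G) (f : group_ring int G).

Lemma gr_eltM x y : gr_elt x * gr_elt y = gr_elt (x * y)%g :> group_ring int G.
Proof. by rewrite [LHS]gr_mulUU mulr1. Qed.

Lemma mcoeff_eltMl h f x : mcoeff x (gr_elt h * f) = mcoeff (h^-1 * x)%g f.
Proof.
elim/gr_ind: f => [|f g hf hg|y a].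
- by rewrite mulr0 !mcoeff0.
- by rewrite mulrDr !mcoeffD hf hg.
rewrite [_ * _]gr_mulUU mul1r !mcoeffU; congr (_ *+ _); congr nat_of_bool.
by apply/eqP/eqP => [<-|->]; rewrite ?mulKg ?mulVKg.
Qed.

Lemma mcoeff_eltMr h f x : mcoeff x (f * gr_elt h) = mcoeff (x * h^-1)%g f.
Proof.
elim/gr_ind: f => [|f g hf hg|y a].
- by rewrite mul0r !mcoeff0.
- by rewrite mulrDl !mcoeffD hf hg.
rewrite [_ * _]gr_mulUU mulr1 !mcoeffU; congr (_ *+ _); congr nat_of_bool.
by apply/eqP/eqP => [<-|->]; rewrite ?mulgK ?mulgVK.
Qed.

(** Powers of [h] may repeat for [k < n], so coefficients can exceed 1; the later arguments use only
    their signs. *)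
Lemma mcoeff_geom x h n :
  mcoeff x (gr_geom h n : group_ring int G) = \sum_(k < n) ((h ^+ k)%g == x)%:R.
Proof.
elim: n => [|n ihn]; first by rewrite /gr_geom !big_ord0 mcoeff0.
rewrite /gr_geom !big_ord_recr /= mcoeffD -ihn; congr (_ + _).
by rewrite mcoeffU.
Qed.

Lemma mcoeff_geom_ge0 x h n : 0 <= mcoeff x (gr_geom h n : group_ring int G).
Proof. by rewrite mcoeff_geom; apply: sumr_ge0 => k _; apply: ler0n. Qed.

Lemma mcoeff_geomP x h n :
  0 < mcoeff x (gr_geom h n : group_ring int G) -> exists k, x = (h ^+ k)%g.
Proof.
rewrite mcoeff_geom => /gt_eqF/negbT hk.
apply: contrapT => nx; case/eqP: hk; apply: big1 => k _.
by case: eqP => // hx; case: nx; exists k.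
Qed.

Lemma mcoeff1_geom h n :
  (0 < n)%N -> 0 < mcoeff 1%g (gr_geom h n : group_ring int G).
Proof.
case: n => // n _; rewrite mcoeff_geom big_ord_recl expg0 eqxx.
by rewrite ltr_pwDl ?ltr01 // sumr_ge0 // => k _; apply: ler0n.
Qed.

(** Multiplication by [h] shifts every exponent by one, and the last term [h ^+ n] wraps around to
    [h ^+ 0]. *)
Lemma geom_eltr h n : (h ^+ n)%g = 1%g ->
  gr_geom h n * gr_elt h = gr_geom h n :> group_ring int G.
Proof.
case: n => [|n] hn; first by rewrite /gr_geom !big_ord0 mul0r.
rewrite /gr_geom mulr_suml big_ord_recr [RHS]big_ord_recl /= addrC.
by rewrite gr_eltM -expgSr hn expg0; congr (_ + _); apply: eq_bigr => i _;
  rewrite gr_eltM -expgSr.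
Qed.

Lemma geom_eltl h n : (h ^+ n)%g = 1%g ->
  gr_elt h * gr_geom h n = gr_geom h n :> group_ring int G.
Proof.
move=> /geom_eltr {2}<-; rewrite /gr_geom mulr_sumr mulr_suml.
by apply: eq_bigr => i _; rewrite !gr_eltM -expgS -expgSr.
Qed.

Lemma mcoeff_geomMl_ge0 h f n :
  (forall x, 0 <= mcoeff x f) -> forall x, 0 <= mcoeff x (gr_geom h n * f).
Proof.
move=> f0 x; rewrite /gr_geom mulr_suml.
elim/big_ind: _ => [|u v hu hv|k _]; first by rewrite mcoeff0.
- by rewrite mcoeffD addr_ge0.
- by rewrite mcoeff_eltMl.
Qed.

(** The product is a sum of left translates of [gr_geom h2 n2] by powers of [h1]; off the product
    set each translate has coefficient 0. *)
Lemma mcoeff_geomM_gt0 h1 n1 h2 n2 x :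
  0 < mcoeff x (gr_geom h1 n1 * gr_geom h2 n2 : group_ring int G) ->
  exists i j, x = (h1 ^+ i * h2 ^+ j)%g.
Proof.
have [//|nx] := pselect (exists i j, x = (h1 ^+ i * h2 ^+ j)%g).
suff -> : mcoeff x (gr_geom h1 n1 * gr_geom h2 n2 : group_ring int G) = 0.
  by rewrite ltxx.
rewrite /gr_geom mulr_suml -/(gr_geom h2 n2).
elim/big_ind: _ => [|u v hu hv|i _]; first by rewrite mcoeff0.
  by rewrite mcoeffD hu hv.
rewrite mcoeff_eltMl; apply/eqP; rewrite eq_le mcoeff_geom_ge0 andbT leNgt.
apply/negP => /mcoeff_geomP[j hj]; case: nx; exists i, j.
by rewrite -hj mulVKg.
Qed.

(** The two leading terms 1 multiply to 1, and nothing negative can cancel this contribution. *)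
Lemma mcoeff1_geomM h1 n1 h2 n2 : (0 < n1)%N -> (0 < n2)%N ->
  0 < mcoeff 1%g (gr_geom h1 n1 * gr_geom h2 n2 : group_ring int G).
Proof.
case: n1 => // n1 _ n2_gt0.
have -> : gr_geom h1 n1.+1
    = 1 + gr_elt h1 * gr_geom h1 n1 :> group_ring int G.
  rewrite /gr_geom big_ord_recl expg0 mulr_sumr; congr (_ + _).
  by apply: eq_bigr => i _; rewrite gr_eltM -expgS.
rewrite mulrDl mul1r mcoeffD ltr_pwDl ?mcoeff1_geom // -mulrA mcoeff_eltMl.
by apply: mcoeff_geomMl_ge0 => x; apply: mcoeff_geom_ge0.
Qed.

End GroupRingTheory.

(** * The pair [A], [B] in any group satisfying three non-degeneracy conditions *)

Section ZeroDivisorPair.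
Variables (G : groupType) (n : nat) (a1 a2 : G).
Let c : G := (a1 * a2 * a1^-1 * a2^-1)%g.
Let A : group_ring int G := gr_geom c n * (1 - gr_elt (a1 * a2 * a1^-1)).
Let B : group_ring int G := (1 - gr_elt a1) * gr_geom a2 n.
Hypotheses (n_gt0 : (0 < n)%N) (a2n : (a2 ^+ n = 1)%g) (cn : (c ^+ n = 1)%g).

Let bE : (a1 * a2 * a1^-1 = c * a2)%g.
Proof. by rewrite /c mulgVK. Qed.

Lemma commutator_pair_mul0 : A * B = 0.
Proof.
have hM : (1 - gr_elt (a1 * a2 * a1^-1)) * B
    = gr_geom a2 n - gr_elt c * gr_geom a2 n :> group_ring int G.
  (* Absorbing [a2] into [gr_geom a2 n] turns [a1 * a2] into [a1] and [c * a2] into [c]; the two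
     [a1] terms then cancel. *)
  rewrite /B mulrA mulrBl mul1r mulrBr mulr1 gr_eltM mulgVK -(gr_eltM a1 a2).
  rewrite !mulrBl mul1r -!mulrA geom_eltl // bE -gr_eltM -mulrA geom_eltl //.
  by rewrite opprB addrA subrK.
by rewrite /A -mulrA hM mulrBr mulrA geom_eltr // subrr.
Qed.

(** Natural exponents suffice in these conditions: [a2] and [c] have finite order, so inverses of
    their powers are again powers. *)
Hypothesis a1_conj : forall k l,
  (a2 ^+ k * a1 = a1 * a2 ^+ l)%g -> (a2 ^+ k = 1)%g.
Hypothesis a1_notin : forall i j, (c ^+ i * a1 * a2 ^+ j <> 1)%g.
Hypothesis a2_notin : forall k, (a2 * c ^+ k <> 1)%g.

Let coefB x : mcoeff x B =
  mcoeff x (gr_geom a2 n : group_ring int G)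
  - mcoeff (a1^-1 * x)%g (gr_geom a2 n : group_ring int G).
Proof. by rewrite /B mulrBl mul1r mcoeffB mcoeff_eltMl. Qed.

Let coefA x : mcoeff x A =
  mcoeff x (gr_geom c n : group_ring int G)
  - mcoeff (x * (c * a2)^-1)%g (gr_geom c n : group_ring int G).
Proof. by rewrite /A mulrBr mulr1 mcoeffB mcoeff_eltMr bE. Qed.

Let B1_gt0 : 0 < mcoeff 1%g B.
Proof.
rewrite coefB; set u := mcoeff (_ * _)%g _.
have [u_gt0|u_le0] := ltP 0 u; last first.
  by rewrite ltr_pwDl ?mcoeff1_geom // oppr_ge0.
have [k] := mcoeff_geomP u_gt0; rewrite mulg1 => hk.
by case: (@a1_notin 0%N k); rewrite expg0 mul1g -hk mulgV.
Qed.

Let Ba1_lt0 : mcoeff a1 B < 0.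
Proof.
rewrite coefB mulVg; set u := mcoeff a1 _.
have [u_gt0|u_le0] := ltP 0 u; last first.
  by rewrite subr_lt0 (le_lt_trans u_le0) ?mcoeff1_geom.
have [k hk] := mcoeff_geomP u_gt0.
(* [a2 ^+ (k * n.-1)] is the inverse of [a2 ^+ k], because [a2 ^+ n = 1]. *)
case: (@a1_notin 0%N (k * n.-1)%N); rewrite expg0 mul1g {1}hk -expgnDr.
by rewrite -mulnS prednK // mulnC expgnA a2n expg1n.
Qed.

Let A1_gt0 : 0 < mcoeff 1%g A.
Proof.
rewrite coefA; set u := mcoeff (_ * _)%g _.
have [u_gt0|u_le0] := ltP 0 u; last first.
  by rewrite ltr_pwDl ?mcoeff1_geom // oppr_ge0.
have [k] := mcoeff_geomP u_gt0; rewrite mul1g => hk.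
(* Here [c ^+ k] is the inverse of [c * a2]; one more factor [c] leaves the inverse of [a2]. *)
by case: (@a2_notin k.+1); rewrite expgSr -hk invgM mulgVK mulgV.
Qed.

(* The sign of a coefficient of B tells which of the cosets <a2>, a1 <a2>
   it lies over; h B = B permutes the coefficients without changing signs, so
   h stabilises both cosets. *)
Lemma geom_left_factor_trivial (h : G) q Y :
  (h ^+ q = 1)%g -> B = gr_geom h q * Y -> h = 1%g.
Proof.
move=> hq BE; have hB : gr_elt h * B = B by rewrite BE mulrA geom_eltl.
have hBE x : mcoeff (h * x)%g B = mcoeff x B.
  by rewrite -{1}hB mcoeff_eltMl mulKg.
have [k hk] : exists k, h = (a2 ^+ k)%g.
  have := B1_gt0; rewrite -hBE mulg1 coefB => h_gt0.
  apply: (@mcoeff_geomP _ _ _ n); apply: lt_le_trans h_gt0 _.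
  by rewrite gerBl mcoeff_geom_ge0.
have [l hl] : exists l, (a1^-1 * (h * a1) = a2 ^+ l)%g.
  have := Ba1_lt0; rewrite -hBE coefB subr_lt0 => h_lt0.
  apply: (@mcoeff_geomP _ _ _ n); apply: le_lt_trans h_lt0.
  exact: mcoeff_geom_ge0.
by rewrite hk; apply: (@a1_conj k l); rewrite -hk -hl mulVKg.
Qed.

Lemma geom_right_factor_absurd (h : G) q X Y : (0 < q)%N ->
  (h ^+ q = 1)%g -> A = X * gr_geom h q -> B = (1 - gr_elt h) * Y -> False.
Proof.
move=> q_gt0 hq AE BE.
have Ah : A * gr_elt h = A by rewrite AE -mulrA geom_eltr.
have [k hk] : exists k, h = (c ^+ k)%g.
  have : 0 < mcoeff h A by rewrite -Ah mcoeff_eltMr mulgV.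
  rewrite coefA => h_gt0.
  apply: (@mcoeff_geomP _ _ _ n); apply: lt_le_trans h_gt0 _.
  by rewrite gerBl mcoeff_geom_ge0.
have hB : gr_geom h q * B = 0.
  by rewrite BE mulrA mulrBr mulr1 geom_eltr // subrr mul0r.
have hsum : gr_geom h q * gr_elt a1 * gr_geom a2 n
    = gr_geom h q * gr_geom a2 n :> group_ring int G.
  by apply/esym/eqP; rewrite -subr_eq0 -mulrA -mulrBr -{1}[gr_geom a2 n]mul1r
    -mulrBl; apply/eqP.
have hconj : gr_geom h q * gr_elt a1
    = gr_elt a1 * gr_geom (h ^ a1)%g q :> group_ring int G.
  rewrite /gr_geom mulr_suml mulr_sumr; apply: eq_bigr => i _.
  by rewrite !gr_eltM -conjXg /conjg mulVKg.
(* The coefficient at 1 of the right side of [hsum] is positive, hence so is that of the left side.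
   By [hconj] this writes [a1^-1] as a power of [h ^ a1] times a power of [a2], that is, 1 as
   [h ^+ i * a1 * a2 ^+ j]. *)
have := mcoeff1_geomM h a2 q_gt0 n_gt0.
rewrite -hsum hconj -mulrA mcoeff_eltMl mulg1 => /mcoeff_geomM_gt0[i [j]].
rewrite -conjXg /conjg -!mulgA -[LHS]mulg1 => /mulgI.
rewrite hk -expgnA => /esym; rewrite mulgA; exact: a1_notin.
Qed.

Lemma commutator_pair_nontrivial : nontrivial_pair A B.
Proof.
split.
  split; last exact: commutator_pair_mul0.
  - by move=> A0; have := A1_gt0; rewrite A0 mcoeff0 ltxx.
  - by move=> B0; have := B1_gt0; rewrite B0 mcoeff0 ltxx.
move=> [X [Y [h [q [q_gt1 [q_gt0 hq hlt]]]]]] [[_ BE]|[AE BE]].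
  by apply: (hlt 1%N); rewrite ?q_gt1 // expg1; apply: geom_left_factor_trivial BE.
exact: geom_right_factor_absurd AE BE.
Qed.

End ZeroDivisorPair.

(** * Group homomorphisms preserve 1, powers and inverses *)

Section GroupMultiplicative.
Local Open Scope group_scope.
Variables (G H : groupType) (f : {multiplicative G -> H}).

Lemma multiplicative1 : f 1 = 1.
Proof. by apply: (mulgI (f 1)); rewrite -gmulfM !mulg1. Qed.

Lemma multiplicativeX k : {morph f : x / x ^+ k}.
Proof.
by elim: k => [|k ihk] x; rewrite ?expg0 ?multiplicative1 // !expgS gmulfM ihk.
Qed.

Lemma multiplicativeV : {morph f : x / x^-1}.
Proof.
by move=> x; apply: (mulgI (f x)); rewrite -gmulfM !mulgV multiplicative1.
Qed.

End GroupMultiplicative.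

(** * Exponent and universal property of the quotient by [n]th powers *)

Section PowerQuotientTheory.
Local Open Scope quotient_scope.
Local Open Scope group_scope.
Variables (F : groupType) (n : nat).

Lemma power_quotient_exp (x : power_quotient F n) : x ^+ n = 1.
Proof.
elim/quotW: x => w; rewrite -[\pi_(_) w]/(pq_proj n w) -multiplicativeX.
apply/power_quotientP; rewrite mulg1; apply: GenV; apply: GenIn.
by exists w.
Qed.

(** [f] kills all [n]th powers, hence the subgroup they generate, so its value does not depend on
    the representative chosen by [repr]. *)
Lemma power_quotient_lift (H : groupType) (f : {multiplicative F -> H}) :
    (forall y : H, y ^+ n = 1) ->
  exists phi : {multiplicative power_quotient F n -> H},
    forall w, phi (pq_proj n w) = f w.
Proof.
move=> Hn.
have f_ker w : power_subgroup n w -> f w = 1.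
  elim=> [_ [x ->]||x y _ fx _ fy|x _ fx].
  - by rewrite multiplicativeX Hn.
  - exact: multiplicative1.
  - by rewrite gmulfM fx fy mulg1.
  - by rewrite multiplicativeV fx invg1.
pose phi (x : power_quotient F n) : H := f (repr x).
have phiE w : phi (pq_proj n w) = f w.
  have /f_ker : power_subgroup n ((repr (pq_proj n w))^-1 * w).
    by apply/power_quotientP; rewrite reprK.
  rewrite gmulfM multiplicativeV => /(canRL (mulVKg _)); rewrite mulg1 => ->.
  by [].
have phiM : {morph phi : x y / x * y}.
  elim/quotW=> x; elim/quotW=> y.
  by rewrite -![\pi_(_) _]/(pq_proj n _) -gmulfM !phiE gmulfM.
pose phiH := isMultiplicative.Build _ _ phi phiM.
pose phi' : {multiplicative power_quotient F n -> H} := HB.pack phi phiH.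
by exists phi'.
Qed.

End PowerQuotientTheory.

(** * The Heisenberg group over a commutative ring *)

Section Heisenberg.
Variable R : comNzRingType.

(* (x, y, z) stands for the unitriangular matrix [[1, x, z], [0, 1, y],
   [0, 0, 1]]. *)
Definition heis : Type := (R * R * R)%type.
HB.instance Definition _ := Choice.on heis.

Definition heis_one : heis := (0, 0, 0).
Definition heis_mul (u v : heis) : heis :=
  (u.1.1 + v.1.1, u.1.2 + v.1.2, u.2 + v.2 + u.1.1 * v.1.2).
Definition heis_inv (u : heis) : heis :=
  (- u.1.1, - u.1.2, - u.2 + u.1.1 * u.1.2).

Lemma heis_mulA : associative heis_mul.
Proof.
by move=> [[x y] z] [[x' y'] z'] [[x'' y''] z'']; congr (_, _, _) => /=; ring.
Qed.

Lemma heis_mul1 : left_id heis_one heis_mul.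
Proof. by move=> [[x y] z]; congr (_, _, _) => /=; ring. Qed.

Lemma heis_mulr1 : right_id heis_one heis_mul.
Proof. by move=> [[x y] z]; congr (_, _, _) => /=; ring. Qed.

Lemma heis_mulV : left_inverse heis_one heis_inv heis_mul.
Proof. by move=> [[x y] z]; congr (_, _, _) => /=; ring. Qed.

Lemma heis_mulrV : right_inverse heis_one heis_inv heis_mul.
Proof. by move=> [[x y] z]; congr (_, _, _) => /=; ring. Qed.

HB.instance Definition _ := isGroup.Build heis
  heis_mulA heis_mul1 heis_mulr1 heis_mulV heis_mulrV.

Lemma heis_mulE (u v : heis) : (u * v)%g
  = (u.1.1 + v.1.1, u.1.2 + v.1.2, u.2 + v.2 + u.1.1 * v.1.2) :> heis.
Proof. by []. Qed.

Lemma heis_invE (u : heis) : (u^-1)%g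
  = (- u.1.1, - u.1.2, - u.2 + u.1.1 * u.1.2) :> heis.
Proof. by []. Qed.

(** The [j]th multiplication adds [j] copies of [x * y] to the corner entry, and 0 + 1 + ... + (k -
    1) is ['C(k, 2)]. *)
Lemma heis_expE (x y z : R) k : (((x, y, z) : heis) ^+ k)%g
  = (x *+ k, y *+ k, z *+ k + (x * y) *+ 'C(k, 2)) :> heis.
Proof.
elim: k => [|k ihk]; first by rewrite expg0 /= !mulr0n addr0.
rewrite expgSr ihk heis_mulE /= binS bin1 !mulrSr !mulrnDr -mulrnAl.
by congr (_, _, _); ring.
Qed.

(** Oddness makes ['C(n, 2)] a multiple of [n], so the corner entry vanishes with the other two. *)
Lemma heis_exponent n : odd n -> n%:R = 0 :> R -> forall u : heis, (u ^+ n = 1)%g.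
Proof.
move=> n_odd n0 [[x y] z]; rewrite heis_expE.
have mul0 (t : R) k : t *+ (n * k) = 0 by rewrite -mulr_natr natrM n0 mul0r mulr0.
by rewrite bin2odd // mul0 -{1 2 3}[n]muln1 !mul0 addr0.
Qed.

End Heisenberg.

Theorem theorem1 :
  exists N : nat, (0 < N)%N /\
  forall n m : nat, odd n -> (N <= n)%N -> (2 <= m)%N ->
  forall b : 'I_m -> free_group 'I_m, free_generators b ->
  forall i1 i2 : 'I_m, i1 <> i2 ->
  let a1 : burnside m n := burnside_proj m n (b i1) in
  let a2 : burnside m n := burnside_proj m n (b i2) in
  let c : burnside m n := (a1 * a2 * a1^-1 * a2^-1)%g in
  let A : group_ring int (burnside m n) :=
    gr_geom c n * (1 - gr_elt (a1 * a2 * a1^-1)) in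
  let B : group_ring int (burnside m n) :=
    (1 - gr_elt a1) * gr_geom a2 n in
  A * B = 0 /\ nontrivial_pair A B.
Proof.
(* The bound 3 excludes [n = 1], where the Burnside group is trivial and [A = B = 0]; moreover
   ['Z_n] is the ring of residues modulo [n] only for [1 < n]. *)
exists 3%N; split=> // n m n_odd n_ge3 _ b b_free i1 i2 i12 a1 a2 c A B.
have n_gt0 : (0 < n)%N by apply: leq_trans n_ge3.
have n_gt1 : (1 < n)%N by apply: leq_trans n_ge3.
have a2_exp : (a2 ^+ n = 1)%g by exact: power_quotient_exp.
have c_exp : (c ^+ n = 1)%g by exact: power_quotient_exp.
split; first exact: commutator_pair_mul0.
pose R := 'Z_n.
have n0 : n%:R = 0 :> R by rewrite pchar_Zp.
pose e1 : heis R := (1, 0, 0); pose e2 : heis R := (0, 1, 0).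
(* All generators other than [b i1] and [b i2] are sent to 1. *)
have [f fE _] := b_free (heis R) (fun i => if i == i1 then e1 else
  if i == i2 then e2 else 1%g).
have [phi phiE] := power_quotient_lift f (heis_exponent n_odd n0).
have phi1 : phi a1 = e1 by rewrite [LHS]phiE fE eqxx.
have phi2 : phi a2 = e2.
  by rewrite [LHS]phiE fE eqxx; case: eqP => // i21; case: i12.
have phic : phi c = (0, 0, 1) :> heis R.
  rewrite /c !gmulfM !multiplicativeV phi1 phi2 !heis_mulE !heis_invE /=.
  by congr (_, _, _); ring.
have r1_neq0 : 1 <> 0 :> R by apply/eqP; rewrite oner_eq0.
apply: commutator_pair_nontrivial => // [k l|i j|k] /(congr1 phi);
  rewrite !gmulfM ?multiplicative1 !multiplicativeX ?phi1 ?phi2 ?phic.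
(* The corner entry is 0 for [e2 ^+ k * e1] and [l] for [e1 * e2 ^+ l], so [l] vanishes modulo [n];
   the second entries give [k = l] there. *)
- rewrite !heis_expE !heis_mulE /= !mul0rn !(mul0r, mul1r, add0r, addr0).
  rewrite !mul0rn add0r => h.
  have kl : k%:R = l%:R :> R := congr1 (fun u : heis R => u.1.2) h.
  have l0 : l%:R = 0 :> R := esym (congr1 (fun u : heis R => u.2) h).
  have /dvdnP[d ->] : (n %| k)%N by rewrite /dvdn -(val_Zp_nat n_gt1) kl l0.
  by rewrite mulnC expgnA a2_exp expg1n.
(* Powers of [c] and [a2] have first entry 0, so the product keeps the entry 1 of [e1]. In the last
   case the second entry 1 of [e2] survives likewise. *)
- rewrite !heis_expE !heis_mulE /= !mul0rn add0r addr0 => h.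
  by apply: r1_neq0; apply: (congr1 (fun u : heis R => u.1.1) h).
- rewrite !heis_expE !heis_mulE /= !mul0rn !addr0 => h.
  by apply: r1_neq0; apply: (congr1 (fun u : heis R => u.1.2) h).
Qed.
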